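(* For any integer $r\ge 3$, if $n$ is a (positive) multiple of $r+1$, then there is an $r$-free digraph $G$ on $n$ vertices such that $$\beta(G)=\frac{n^2}{(r+1)^2}.$$
   Context: All digraphs are finite and oriented: no loops, no parallel edges, no antiparallel edges. A digraph is $r$-free if it contains no directed cycle of length at most $r$. A feedback arc set of $G=(V,E)$ is a set $S\subset E$ such that $(V,E\setminus S)$ has no directed cycles; $\beta(G)$ is the minimum size of a feedback arc set. *)

(* Defs.v *)
From mathcomp Require Import all_boot.

Set Implicit Arguments.
Unset Strict Implicit.
Unset Printing Implicit Defensive.

(* Finite oriented digraphs.  Arcs form a relation, so parallel arcs are
   excluded by construction. *)
Record digraph (V : finType) := Digraph {
  arc :> rel V;
  arc_irr : irreflexive arc;
  arc_asym : forall x y : V, arc x y -> ~~ arc y x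
}.

Section Digraphs.

Variable V : finType.
Implicit Types (e : rel V) (c : seq V) (G : digraph V) (S : {set V * V}).

(* The closing arc, from the last vertex of [c] to the first, is part of
   [ucycleb e c], so [size c] is the number of arcs of the cycle.  The empty
   sequence is a [ucycleb] and has to be excluded. *)
Definition dicycle e c : bool := (0 < size c) && ucycleb e c.

Definition r_free (r : nat) G : Prop :=
  forall c, size c <= r -> ~~ dicycle G c.

(* The vertices of a directed cycle are distinct, so bounding the length by
   [#|V|] loses nothing; see [acyclicP]. *)
Definition acyclic e : bool :=
  [forall k : 'I_#|V|.+1, forall c : k.-tuple V, ~~ dicycle e c].

Lemma acyclicP e : reflect (forall c, ~~ dicycle e c) (acyclic e).
Proof.
apply: (iffP forallP) => [H c|H k]; last by apply/forallP => c; apply: H.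
apply/negP => hc; have /andP[_ /andP[_ uc]] := hc.
have lec : size c < #|V|.+1 by rewrite ltnS -(card_uniqP uc) max_card.
by have /forallP/(_ (in_tuple c))/negP := H (Ordinal lec); apply.
Qed.

Definition arcs G : {set V * V} := [set a | G a.1 a.2].

Definition del_arcs G S : rel V := [rel x y | G x y && ((x, y) \notin S)].

Definition feedback_arc_set G S : bool :=
  (S \subset arcs G) && acyclic (del_arcs G S).

Lemma feedback_arcs G : feedback_arc_set G (arcs G).
Proof.
have del0 x y : del_arcs G (arcs G) x y = false by rewrite /del_arcs /= inE andbN.
rewrite /feedback_arc_set subxx; apply/acyclicP => -[|x [|y c]] //.
  by rewrite /dicycle /ucycleb /= del0.
by rewrite /dicycle /ucycleb /= del0.
Qed.

Definition beta G : nat :=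
  #|[arg min_(S < arcs G | feedback_arc_set G S) #|S|]|.

Lemma beta_min G S : feedback_arc_set G S -> beta G <= #|S|.
Proof.
by rewrite /beta; case: arg_minnP => [|S0 _ min]; [apply: feedback_arcs|apply: min].
Qed.

Lemma beta_attained G : exists2 S, feedback_arc_set G S & #|S| = beta G.
Proof.
by rewrite /beta; case: arg_minnP => [|S0 fS0 _]; [apply: feedback_arcs|exists S0].
Qed.

End Digraphs.

(* Main.v *)
Require Import Defs.
From HB Require Import structures.
From mathcomp Require Import all_boot all_order all_algebra.

(** The digraph is the balanced blow-up of the directed cycle of length
    [k = r + 1]: with [n = m * k], the vertices fall into [k] residue classes
    mod [k], each of size [m], and [u -> v] is an arc when [v] lies in the class
    that follows the class of [u].

    A walk of length [l] shifts the residue by [l], so the length of a directed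
    cycle is a multiple of [k]; hence there is none of length at most [r]
    ([dicycle_blowup_size]).

    The [m ^ 2] arcs that go from class [r] to class [0] form a feedback arc
    set, because all other arcs increase the residue ([cut_feedback]).

    Conversely [m ^ 2] arcs are necessary, because the digraph contains [m ^ 2]
    arc-disjoint cycles of length [k] ([feedback_blowup_ge]).  They are indexed
    by pairs [(a, b)] in [Z/m]: the cycle of [(a, b)] visits, in the successive
    classes, the vertices of index [a, b, a, b, ...], except that in the last
    class it visits the one of index [a + b].  Any two cyclically consecutive
    entries of this sequence determine [a] and [b] ([label_inj]), so an arc
    belongs to at most one of these cycles; this works for [k] odd or even. *)

Set Implicit Arguments.
Unset Strict Implicit.
Unset Printing Implicit Defensive.

Import GRing.Theory.

(** * Cycles and closed walks *)

Lemma path_map_iota (V : Type) (e : rel V) (f : nat -> V) j l :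
  (forall i, e (f i) (f i.+1)) -> path e (f j) [seq f i | i <- iota j.+1 l].
Proof. by move=> ef; elim: l j => //= l IHl j; rewrite ef IHl. Qed.

(** The simple cycle [f 0, ..., f r] is presented as a periodic sequence on
    [nat], so that its closing step has the same form as the others. *)
Lemma acyclic_missing_step (V : finType) (e : rel V) (f : nat -> V) r :
  acyclic e -> {in gtn r.+1 &, injective f} ->
  (forall i, f (i %% r.+1) = f i) ->
  exists i : 'I_r.+1, ~~ e (f i) (f i.+1).
Proof.
move=> /acyclicP ac injf per; apply/existsP; apply: contraT => /existsPn ef.
have {}ef i : e (f i) (f i.+1).
  have /negPn := ef (inZp i).
  by rewrite /= per -(per (_ %% _).+1) -addn1 modnDml addn1 per.
have /negP[] := ac [seq f i | i <- iota 0 r.+1].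
rewrite /dicycle /= /ucycleb; apply/andP; split.
  (* The closing step is the one from [f r] to [f r.+1]. *)
  have -> : f 0 = f r.+1 by rewrite -(per r.+1) modnn.
  rewrite /= -map_rcons -cats1 -(iotaD 1 r 1) addn1.
  by rewrite -[f r.+1]per modnn path_map_iota.
rewrite -[_ :: _]/(map f (iota 0 r.+1)) map_inj_in_uniq ?iota_uniq // => i j.
by rewrite !mem_iota => hi hj; apply: injf.
Qed.

Lemma increasing_acyclic (V : finType) (e : rel V) (h : V -> nat) :
  (forall x y, e x y -> h x < h y) -> acyclic e.
Proof.
move=> eh; apply/acyclicP => -[//|x c]; apply/negP => /andP[_ /andP[/= pc _]].
have {}pc : path (relpre h ltn) x (rcons c x) by apply: sub_path pc.
have tr : transitive (relpre h ltn) by move=> ? ? ?; apply: ltn_trans.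
have /(_ x) := allP (order_path_min tr pc).
by rewrite mem_rcons mem_head /= ltnn => /(_ isT).
Qed.

(** * The blow-up of a directed cycle *)

Section Blowup.

Variables (r n : nat) (r_gt1 : 1 < r).
Let k := r.+1.

Definition next_class : rel 'I_n := [rel u v : 'I_n | v == u.+1 %[mod k]].

Lemma next_class_path u c :
  path next_class u c -> last u c = u + size c %[mod k].
Proof.
elim: c u => [|v c IHc] u /=; first by rewrite addn0.
case/andP=> /eqP uv /IHc ->.
by rewrite -modnDml uv modnDml addSnnS.
Qed.

Lemma next_class_closed u c :
  path next_class u (rcons c u) -> k %| (size c).+1.
Proof.
move/next_class_path/eqP; rewrite last_rcons size_rcons eq_sym.
by rewrite -{2}[nat_of_ord u]addn0 eqn_modDl mod0n.
Qed.

Lemma next_class_irr : irreflexive next_class.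
Proof.
move=> u; apply/negP => uu; have := @next_class_closed u [::].
by rewrite /= andbT => /(_ uu); rewrite dvdn1 eqSS gtn_eqF // ltnW.
Qed.

Lemma next_class_asym u v : next_class u v -> ~~ next_class v u.
Proof.
move=> uv; apply/negP => vu; have := @next_class_closed u [:: v].
rewrite /= andbT => /(_ (introT andP (conj uv vu))) /dvdn_leq -/(_ isT).
by apply/negP; rewrite -ltnNge.
Qed.

Definition blowup : digraph 'I_n := Digraph next_class_irr next_class_asym.

Lemma dicycle_blowup_size c : dicycle blowup c -> r < size c.
Proof.
case: c => [//|u c] /andP[_ /andP[/next_class_closed kc _]].
exact: dvdn_leq kc.
Qed.

End Blowup.

(** * Arc-disjoint cycles *)

Section Balanced.

(* [m = m'.+1] is the size of the classes; the successor form makes ['I_m]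
   the group Z/m. *)
Variables (r m' : nat) (r_gt1 : 1 < r).
Let k := r.+1.
Let m := m'.+1.
Let G := @blowup r (m * k) r_gt1.

Lemma vertex_subproof (x : 'I_m) (i : 'I_k) : x * k + i < m * k.
Proof.
by rewrite (leq_trans (n := x.+1 * k)) ?leq_pmul2r // mulSn addnC ltn_add2r.
Qed.

Definition vertex x i : 'I_(m * k) := Ordinal (vertex_subproof x i).

Lemma vertex_mod x i : vertex x i %% k = i.
Proof. by rewrite /= modnMDl modn_small. Qed.

Lemma vertex_div x i : vertex x i %/ k = x.
Proof. by rewrite /= divnMDl // divn_small ?addn0. Qed.

Lemma vertexP (u : 'I_(m * k)) (i : 'I_k) :
  u %% k = i -> exists x, u = vertex x i.
Proof.
move=> ui; have um : u %/ k < m by rewrite ltn_divLR.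
by exists (Ordinal um); apply: val_inj; rewrite /= -ui -divn_eq.
Qed.

Definition cut : {set 'I_(m * k) * 'I_(m * k)} :=
  [set (vertex xy.1 ord_max, vertex xy.2 ord0) | xy : 'I_m * 'I_m].

Lemma cut_feedback : feedback_arc_set G cut.
Proof.
apply/andP; split.
  apply/subsetP => _ /imsetP[[x y] _ ->].
  by rewrite inE; apply/eqP; rewrite /= -addnS !modnMDl modnn.
(* Only an arc that leaves class [r] can fail to increase the residue. *)
apply: (@increasing_acyclic _ _ (fun u : 'I__ => u %% k)) => u v.
case/andP=> /eqP uv; apply: contraR; rewrite -leqNgt uv.
have [ur|ur] := eqVneq (u %% k) r.
  have [x ->] := @vertexP u ord_max ur.
  have [|y ->] := @vertexP v ord0; last first.
    by move=> _; apply: (imset_f _ (x := (x, y))).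
  by rewrite uv -addn1 -modnDml ur addn1 modnn.
rewrite -addn1 -modnDml addn1 modn_small ?ltnn //.
by rewrite ltnS ltn_neqAle ur -ltnS ltn_pmod.
Qed.

Lemma card_cut : #|cut| <= m ^ 2.
Proof.
by rewrite (leq_trans (leq_imset_card _ _)) // card_prod card_ord.
Qed.

(** The index, inside class [i], of the vertex visited by the cycle of
    [(a, b)]. *)
Definition label (ab : 'I_m * 'I_m) (i : nat) : 'I_m :=
  if i == r then (ab.1 + ab.2)%R else if odd i then ab.2 else ab.1.

(** Two cyclically consecutive labels are [a] and [b] in some order, or one of
    [a], [b] together with [a + b], from which the other is recovered by
    cancellation.  The consecutive pair in last and first place is
    [(a + b, a)], as [0] differs from [r]. *)
Lemma label_inj i ab cd : i < k ->
  label ab i = label cd i -> label ab (i.+1 %% k) = label cd (i.+1 %% k) ->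
  ab = cd.
Proof.
case: ab cd => [a b] [c d]; rewrite ltnS leq_eqVlt => /predU1P[->|ir].
  rewrite modnn /label eqxx ltn_eqF ?(ltnW r_gt1) //= => ab_cd ac.
  by move: ab_cd; rewrite ac => /addrI ->.
rewrite modn_small // /label (ltn_eqF ir) /=.
case: eqP => _; case: (odd i) => /=.
- by move=> -> /addIr ->.
- by move=> -> /addrI ->.
- by move=> -> ->.
- by move=> -> ->.
Qed.

Definition cycle_vertex ab (i : nat) : 'I_(m * k) :=
  vertex (label ab (i %% k)) (inZp i).

Lemma cycle_vertex_mod ab i : cycle_vertex ab i %% k = i %% k.
Proof. exact: vertex_mod. Qed.

Lemma cycle_vertex_div ab i : cycle_vertex ab i %/ k = label ab (i %% k).
Proof. exact: vertex_div. Qed.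

Lemma cycle_vertex_arc ab i : G (cycle_vertex ab i) (cycle_vertex ab i.+1).
Proof.
apply/eqP; rewrite cycle_vertex_mod.
by rewrite -(addn1 (cycle_vertex _ _)) -modnDml cycle_vertex_mod modnDml addn1.
Qed.

(** A feedback arc set takes an arc from each of the cycles, and an arc
    determines the cycle it was taken from. *)
Lemma feedback_blowup_ge S : feedback_arc_set G S -> m ^ 2 <= #|S|.
Proof.
case/andP=> _ acS.
pose step ab i := (cycle_vertex ab i, cycle_vertex ab i.+1).
have hit ab : exists i : 'I_k, step ab i \in S.
  have [||i] := acyclic_missing_step (r := r) (f := cycle_vertex ab) acS.
  - move=> i j ik jk /(congr1 (fun u : 'I__ => u %% k)).
    by rewrite !cycle_vertex_mod !modn_small.
  - move=> i; rewrite /cycle_vertex modn_mod; congr vertex.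
    by apply: val_inj; rewrite /= modn_mod.
  case/nandP => [/negP[]|/negPn]; last by exists i.
  exact: cycle_vertex_arc.
pose pick ab := step ab (xchoose (hit ab)).
have pick_inj : injective pick.
  move=> ab cd; rewrite /pick.
  move: (xchoose _) (xchoose _) => i j eq_step.
  have /(congr1 val) eq1 := congr1 fst eq_step.
  have /(congr1 val) eq2 := congr1 snd eq_step.
  have ij : i = j.
    apply: val_inj; move: (congr1 (modn^~ k) eq1).
    by rewrite !cycle_vertex_mod !modn_small.
  rewrite -ij in eq1 eq2; apply: (@label_inj i) => //; apply: val_inj.
    by move: (congr1 (divn^~ k) eq1); rewrite !cycle_vertex_div modn_small.
  by move: (congr1 (divn^~ k) eq2); rewrite !cycle_vertex_div.
have -> : m ^ 2 = #|[set pick ab | ab : 'I_m * 'I_m]|.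
  by rewrite card_imset // card_prod card_ord.
apply: subset_leq_card; apply/subsetP => _ /imsetP[ab _ ->].
exact: (xchooseP (hit ab)).
Qed.

Lemma beta_blowup : beta G = m ^ 2.
Proof.
apply/eqP; rewrite eqn_leq (leq_trans (beta_min cut_feedback) card_cut) /=.
by have [S /feedback_blowup_ge ? <-] := beta_attained G.
Qed.

End Balanced.

Local Open Scope ring_scope.

Theorem proposition5p5 (r n : nat) (hr : (3 <= r)%N) (hn : (0 < n)%N)
    (hrn : (r.+1 %| n)%N) :
  exists G : digraph 'I_n,
    r_free r G /\ (beta G)%:R = n%:R ^+ 2 / (r%:R + 1) ^+ 2 :> rat.
Proof.
case/dvdnP: hrn hn => -[|m'] -> // _.
exists (blowup (m'.+1 * r.+1) (ltnW hr)); split.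
  by move=> c; apply: contraL => /dicycle_blowup_size; rewrite -ltnNge.
rewrite beta_blowup natrM natr1 natrX exprMn mulfK //.
by rewrite expf_neq0 // Num.Theory.pnatr_eq0.
Qed.
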